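(* Let $k\geq 2$ and let $(x_n)_{n\geq 0}$ be a sequence of integers satisfying $x_n=b_1x_{n-1}+b_2x_{n-2}+\dots+b_kx_{n-k}$ for all integers $n\geq k$, where $b_1,\dots,b_k\in\mathbb{Z}$, $b_k\neq 0$, with initial values $x_0=x_1=\dots=x_{k-2}=0$, $x_{k-1}=1$. Suppose that the characteristic polynomial $x^k-b_1x^{k-1}-\dots-b_k$ equals $(x-a)^k$ for some $a\in\mathbb{Z}$. If $p$ is a prime with $p\nmid a$, then the quotient set of $(x_n)_{n\geq 0}$ is dense in $\mathbb{Q}_p$.
   Context: The quotient set (ratio set) of a sequence $(x_n)_{n\ge0}$ of integers is $\{x_m/x_n : m,n\geq 0,\ x_n\neq 0\}$. $\mathbb{Q}_p$ denotes the field of $p$-adic numbers with the $p$-adic topology. *)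

(* Defs.v *)
From HB Require Import structures.
From mathcomp Require Import all_boot all_order all_algebra.
From mathcomp Require Import generic_quotient ring_quotient.
From mathcomp Require Import all_classical topology_theory.topology.
From mathcomp Require Import zify ring lra.
Set Implicit Arguments.
Unset Strict Implicit.
Unset Printing Implicit Defensive.
Import Order.TTheory GRing.Theory Num.Theory.
Local Open Scope classical_set_scope.
Local Open Scope ring_scope.

(* Since [logn p _ = 0] when [p] is not prime, the formula below is then the
   trivial absolute value, so that everything that follows makes sense for
   every [p : nat]. *)
Definition padic_val (p : nat) (q : rat) : int :=
  (logn p `|numq q|)%:Z - (logn p `|denq q|)%:Z.

Definition padic_norm (p : nat) (q : rat) : rat :=
  if q == 0 then 0 else p%:R ^ (- padic_val p q).

Section PadicNorm.
Variable p : nat.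
Local Notation N := (padic_norm p).

Lemma logn_nprime (n : nat) : ~~ prime p -> logn p n = 0%N.
Proof. by rewrite lognE => /negPf ->. Qed.

Lemma padic_norm0 : N 0 = 0. Proof. by rewrite /padic_norm eqxx. Qed.

Lemma padic_normE (a b : int) : a != 0 -> b != 0 ->
  N (a%:~R / b%:~R) = p%:R ^ ((logn p `|b|)%:Z - (logn p `|a|)%:Z).
Proof.
move=> a0 b0; rewrite /padic_norm mulf_eq0 invr_eq0 !intr_eq0 (negPf a0) (negPf b0) /=.
congr (_ ^ _); rewrite /padic_val; set q := _ / _.
have E : numq q * b = a * denq q.
  apply/(@intr_inj rat); rewrite !rmorphM /= numqE /q.
  by rewrite mulrAC divfK ?intr_eq0.
have q0 : q != 0 by rewrite mulf_eq0 invr_eq0 !intr_eq0 (negPf a0) (negPf b0).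
have : logn p `|numq q * b| = logn p `|a * denq q| by rewrite E.
have h (z : int) : z != 0 -> (0 < `|z|)%N by rewrite absz_gt0.
rewrite !abszM !lognM ?h ?numq_eq0 ?denq_neq0 // => E'.
by move: (congr1 Posz E'); rewrite !PoszD => E2; lia.
Qed.

Lemma padic_normz (a : int) : a != 0 -> N a%:~R = p%:R ^- logn p `|a|.
Proof.
move=> a0; have := @padic_normE a 1 a0 isT.
by rewrite divr1 logn1 sub0r -exprnN.
Qed.

Lemma padic_pow_gt0 (a : nat) : 0 < p%:R ^+ logn p a :> rat.
Proof.
case pp : (prime p); last by rewrite logn_nprime ?pp // expr0.
by rewrite exprn_gt0 // ltr0n prime_gt0.
Qed.

Lemma padic_norm_div (a b : int) : a != 0 -> b != 0 ->
  N (a%:~R / b%:~R) = p%:R ^+ logn p `|b| / p%:R ^+ logn p `|a|.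
Proof.
move=> a0 b0; rewrite padic_normE //.
case pp : (prime p); last by rewrite !logn_nprime ?pp // subrr expr0z divr1.
by rewrite expfzDr ?pnatr_eq0 -?lt0n ?prime_gt0 // -exprnN.
Qed.

Lemma ratP_div (q : rat) : q != 0 ->
  exists2 a : int, a != 0 & exists2 b : int, b != 0 & q = a%:~R / b%:~R.
Proof.
move=> q0; exists (numq q); first by rewrite numq_eq0.
by exists (denq q); [exact: denq_neq0 | rewrite divq_num_den].
Qed.

Lemma padic_norm1 : N 1 = 1.
Proof. by rewrite -[1]/(1%:~R) padic_normz // logn1 expr0 invr1. Qed.

Lemma padic_norm_gt0 q : (0 < N q) = (q != 0).
Proof.
have [->|q0] := eqVneq; first by rewrite padic_norm0 ltxx.
have [a a0 [b b0 ->]] := ratP_div q0.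
by rewrite padic_norm_div // divr_gt0 ?padic_pow_gt0.
Qed.

Lemma padic_norm_ge0 q : 0 <= N q.
Proof.
by have [->|q0] := eqVneq q 0; [rewrite padic_norm0 | rewrite ltW ?padic_norm_gt0].
Qed.

Lemma padic_norm_eq0 q : (N q == 0) = (q == 0).
Proof.
have [->|q0] := eqVneq q 0; first by rewrite padic_norm0 eqxx.
by apply/negbTE; rewrite gt_eqF ?padic_norm_gt0.
Qed.

Lemma padic_normM x y : N (x * y) = N x * N y.
Proof.
have [->|x0] := eqVneq x 0; first by rewrite mul0r padic_norm0 mul0r.
have [->|y0] := eqVneq y 0; first by rewrite mulr0 padic_norm0 mulr0.
have [a a0 [b b0 ->]] := ratP_div x0.
have [c c0 [d d0 ->]] := ratP_div y0.
rewrite mulf_div -!rmorphM /= !padic_norm_div ?mulf_neq0 //.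
by rewrite !abszM !lognM ?absz_gt0 // !exprD mulf_div.
Qed.

Lemma padic_normV x : N x^-1 = (N x)^-1.
Proof.
have [->|x0] := eqVneq x 0; first by rewrite invr0 padic_norm0.
apply: (mulfI (x := N x)); first by rewrite padic_norm_eq0.
by rewrite -padic_normM !divff ?padic_norm1 // padic_norm_eq0.
Qed.

Lemma padic_normN x : N (- x) = N x.
Proof.
rewrite /padic_norm oppr_eq0; case: eqP => // /eqP x0.
by rewrite /padic_val numqN denqN abszN.
Qed.

Lemma padic_normB x y : N (x - y) = N (y - x).
Proof. by rewrite -padic_normN opprB. Qed.

Lemma padic_normz_ultra (a b : int) :
  N (a + b)%:~R <= Num.max (N a%:~R) (N b%:~R).
Proof.
have [->|a0] := eqVneq a 0.
  by rewrite add0r padic_norm0 le_max lexx orbT.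
have [->|b0] := eqVneq b 0.
  by rewrite addr0 le_max lexx.
have [->|ab0] := eqVneq (a + b) 0; first by rewrite padic_norm0 le_max padic_norm_ge0.
rewrite !padic_normz //.
case pp : (prime p); last by rewrite !logn_nprime ?pp // expr0 invr1 le_max lexx.
have p1 : 1 < p%:R :> rat by rewrite ltr1n prime_gt1.
rewrite le_max !lef_pV2 ?posrE ?padic_pow_gt0 // !ler_eXn2l //.
rewrite -geq_min -pfactor_dvdn ?absz_gt0 //.
set k := minn _ _.
suff : ((p ^ k)%N%:Z %| a + b)%Z by [].
have h (c : int) : c != 0 -> (k <= logn p `|c|)%N -> ((p ^ k)%N%:Z %| c)%Z.
  by move=> c0 kc; rewrite dvdzE absz_nat pfactor_dvdn ?absz_gt0.
by apply: rpredD; apply: h => //; rewrite ?geq_minl ?geq_minr.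
Qed.

Lemma padic_norm_ultra x y : N (x + y) <= Num.max (N x) (N y).
Proof.
rewrite -[x]divq_num_den -[y]divq_num_den addf_div ?intr_eq0 ?denq_neq0 //.
have -> : (numq x)%:~R / (denq x)%:~R =
    (numq x * denq y)%:~R / (denq x * denq y)%:~R :> rat.
  by rewrite !rmorphM /= -mulf_div divff ?mulr1 // intr_eq0 denq_neq0.
have -> : (numq y)%:~R / (denq y)%:~R =
    (numq y * denq x)%:~R / (denq x * denq y)%:~R :> rat.
  rewrite !rmorphM /= [in RHS](mulrC (denq x)%:~R) -mulf_div divff ?mulr1 //.
  by rewrite intr_eq0 denq_neq0.
rewrite -!rmorphM -rmorphD /= !(padic_normM _ (_^-1)) -maxr_pMl ?padic_norm_ge0 //.
by rewrite ler_wpM2r ?padic_norm_ge0 // padic_normz_ultra.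
Qed.

Lemma padic_normD_lt x y e : N x < e -> N y < e -> N (x + y) < e.
Proof.
by move=> xe ye; rewrite (le_lt_trans (padic_norm_ultra _ _)) // gt_max xe.
Qed.

Lemma padic_normB_lt x y e : N x < e -> N y < e -> N (x - y) < e.
Proof. by move=> xe ye; rewrite padic_normD_lt // padic_normN. Qed.

Lemma padic_norm_close x y : N (x - y) < N x -> N y = N x.
Proof.
move=> h; apply/eqP; rewrite eq_le; apply/andP; split.
  rewrite -[y](subrKC x); apply: le_trans (padic_norm_ultra _ _) _.
  by rewrite ge_max lexx padic_normB ltW.
rewrite leNgt; apply/negP => yx.
by have := padic_normD_lt h yx; rewrite subrK ltxx.
Qed.

End PadicNorm.

Definition padic_cauchy (p : nat) (u : nat -> rat) : Prop :=
  forall e : rat, 0 < e -> exists N, forall m n, (N <= m)%N -> (N <= n)%N ->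
    padic_norm p (u m - u n) < e.

Definition padic_null (p : nat) (u : nat -> rat) : Prop :=
  forall e : rat, 0 < e -> exists N, forall n, (N <= n)%N ->
    padic_norm p (u n) < e.

Section PadicCauchy.
Variable p : nat.
Local Notation N := (padic_norm p).
Implicit Types u v : nat -> rat.

Lemma padic_cauchy_bounded u : padic_cauchy p u ->
  exists2 M : rat, 0 < M & exists k, forall n, (k <= n)%N -> N (u n) < M.
Proof.
move=> /(_ 1 ltr01) [k hk]; exists (N (u k) + 1).
  by rewrite ltr_wpDl ?padic_norm_ge0.
exists k => n kn; rewrite -[u n](subrK (u k)).
apply: padic_normD_lt; last by rewrite ltrDl.
by rewrite (lt_le_trans (hk _ _ kn _)) // lerDr padic_norm_ge0.
Qed.

Lemma padic_cauchy_cst (q : rat) : padic_cauchy p (fun=> q).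
Proof. by move=> e e0; exists 0%N => *; rewrite subrr padic_norm0. Qed.

Lemma padic_cauchyB u v : padic_cauchy p u -> padic_cauchy p v ->
  padic_cauchy p (u - v).
Proof.
move=> hu hv e e0; have [a ha] := hu e e0; have [b hb] := hv e e0.
exists (maxn a b) => m n; rewrite !geq_max => /andP[am bm] /andP[an bn].
rewrite !fctE.
have -> : u m - v m - (u n - v n) = (u m - u n) - (v m - v n) by ring.
by apply: padic_normB_lt; [exact: ha | exact: hb].
Qed.

Lemma padic_nullM u v : padic_null p u -> padic_cauchy p v ->
  padic_null p (v * u).
Proof.
move=> hu /padic_cauchy_bounded [M M0 [b hb]] e e0.
have [a ha] := hu (e / M) (divr_gt0 e0 M0).
exists (maxn a b) => n; rewrite geq_max => /andP[an bn].
rewrite !fctE padic_normM -(divfK (lt0r_neq0 M0) e) mulrC.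
apply: ltr_pM; rewrite ?padic_norm_ge0 //; [exact: ha | exact: hb].
Qed.

Lemma padic_cauchyM u v : padic_cauchy p u -> padic_cauchy p v ->
  padic_cauchy p (u * v).
Proof.
move=> hu hv e e0.
have [M M0 [a ha]] := padic_cauchy_bounded hu.
have [L L0 [b hb]] := padic_cauchy_bounded hv.
have [c hc] := hu (e / L) (divr_gt0 e0 L0).
have [d hd] := hv (e / M) (divr_gt0 e0 M0).
exists (maxn (maxn a b) (maxn c d)) => m n; rewrite !geq_max.
move=> /andP[/andP[am bm] /andP[cm dm]] /andP[/andP[an bn] /andP[cn dn]].
rewrite !fctE.
have -> : u m * v m - u n * v n = (u m - u n) * v m + (v m - v n) * u n by ring.
apply: padic_normD_lt; rewrite padic_normM.
  rewrite -(divfK (lt0r_neq0 L0) e).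
  by apply: ltr_pM; rewrite ?padic_norm_ge0 ?hc ?hb.
rewrite -(divfK (lt0r_neq0 M0) e).
by apply: ltr_pM; rewrite ?padic_norm_ge0 ?hd ?ha.
Qed.

Lemma padic_nullB u v : padic_null p u -> padic_null p v ->
  padic_null p (u - v).
Proof.
move=> hu hv e e0; have [a ha] := hu e e0; have [b hb] := hv e e0.
exists (maxn a b) => m; rewrite !geq_max => /andP[am bm].
by apply: padic_normB_lt; [exact: ha | exact: hb].
Qed.

Lemma padic_norm_stable u : padic_cauchy p u -> ~ padic_null p u ->
  exists2 c : rat, 0 < c & exists k, forall n, (k <= n)%N -> N (u n) = c.
Proof.
move=> hu /existsNP [e] /not_implyP [e0 /forallNP he].
have [k hk] := hu e e0; have := he k => /existsNP [m] /not_implyP [km /negP].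
rewrite -leNgt => em; exists (N (u m)); first exact: lt_le_trans em.
by exists k => n kn; apply: padic_norm_close; apply: lt_le_trans em; exact: hk.
Qed.

Lemma padic_cauchyV u : padic_cauchy p u -> ~ padic_null p u ->
  padic_cauchy p (fun n => (u n)^-1).
Proof.
move=> hu nu; have [c c0 [k hk]] := padic_norm_stable hu nu => e e0.
have [l hl] := hu (e * (c * c)) (mulr_gt0 e0 (mulr_gt0 c0 c0)).
exists (maxn k l) => m n; rewrite !geq_max => /andP[km lm] /andP[kn ln].
have um : u m != 0 by rewrite -(padic_norm_gt0 p) hk.
have un : u n != 0 by rewrite -(padic_norm_gt0 p) hk.
have -> : (u m)^-1 - (u n)^-1 = (u n - u m) / (u m * u n) by field; rewrite um un.
by rewrite padic_normM padic_normV padic_normM !hk // ltr_pdivrMr ?mulr_gt0 ?hl.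
Qed.

End PadicCauchy.

Definition padic_cauchy_pred (p : nat) : {pred nat -> rat} :=
  fun u => `[< padic_cauchy p u >].

Record padic_seq (p : nat) := PadicSeq {
  padic_seq_val :> nat -> rat;
  _ : padic_seq_val \in padic_cauchy_pred p }.

HB.instance Definition _ p := [isSub for @padic_seq_val p].
HB.instance Definition _ p := [Choice of padic_seq p by <:].

Lemma padic_cauchy_subring p : subring_closed (padic_cauchy_pred p).
Proof.
split=> [|u v /asboolP hu /asboolP hv|u v /asboolP hu /asboolP hv]; apply/asboolP.
- exact: padic_cauchy_cst.
- exact: padic_cauchyB.
- exact: padic_cauchyM.
Qed.

HB.instance Definition _ p := GRing.isSubringClosed.Build (nat -> rat)
  (padic_cauchy_pred p) (padic_cauchy_subring p).
HB.instance Definition _ p :=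
  [SubChoice_isSubComNzRing of padic_seq p by <:].

Definition padic_null_ideal (p : nat) : {pred padic_seq p} :=
  fun u => `[< padic_null p u >].

Lemma padic_null_idealP p : idealr_closed (@padic_null_ideal p).
Proof.
split.
- by apply/asboolP => e e0; exists 0%N => n _; rewrite padic_norm0.
- apply/negP => /asboolP /(_ 1 ltr01) [k /(_ k (leqnn k))].
  by rewrite padic_norm1 ltxx.
- move=> a u v /asboolP hu /asboolP hv; apply/asboolP.
  have ha : padic_cauchy p a by exact/asboolP/(valP a).
  have -> : a * u + v = a * u - (- v) by rewrite opprK.
  apply: padic_nullB; first exact: padic_nullM.
  by move=> e /hv [k hk]; exists k => n kn; rewrite padic_normN hk.
Qed.

HB.instance Definition _ p := isIdealr.Build (padic_seq p)
  (@padic_null_ideal p) (@padic_null_idealP p).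

(* The completion of [rat]: Cauchy sequences for the p-adic absolute value,
   modulo null sequences. *)
Definition Qp (p : nat) := {ideal_quot (@padic_null_ideal p)}.
HB.instance Definition _ p := GRing.ComNzRing.on (Qp p).

Section QpField.
Variable p : nat.
Local Open Scope quotient_scope.
Implicit Types (u v : padic_seq p) (x y z : Qp p).

Definition padic_seqV u : padic_seq p := insubd 0 (fun n => (u n)^-1).

Definition Qp_inv x : Qp p :=
  if x == 0 then 0 else \pi_(Qp p) (padic_seqV (repr x)).

Lemma padic_seq_cauchy u : padic_cauchy p u.
Proof. exact/asboolP/(valP u). Qed.

Lemma Qp_pi_eq u v :
  (\pi_(Qp p) u = \pi_(Qp p) v) <-> padic_null p (u - v).
Proof.
split=> [/eqP|h]; last apply/eqP.
  by rewrite -Quotient.idealrBE => /asboolP.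
by rewrite -Quotient.idealrBE; apply/asboolP.
Qed.

Lemma Qp_pi_eq0 u : (\pi_(Qp p) u = 0) <-> padic_null p u.
Proof. by rewrite -(rmorph0 (\pi_(Qp p))) Qp_pi_eq subr0. Qed.

Lemma Qp_mulVf x : x != 0 -> Qp_inv x * x = 1.
Proof.
move=> x0; rewrite /Qp_inv (negPf x0).
have nx : ~ padic_null p (repr x).
  by move/Qp_pi_eq0; rewrite reprK => /eqP; exact/negP.
have hx := padic_seq_cauchy (repr x).
rewrite -{2}[x]reprK -rmorphM -(rmorph1 (\pi_(Qp p))).
apply/Qp_pi_eq => e e0.
have [c c0 [k hk]] := padic_norm_stable hx nx; exists k => n kn.
have E : padic_seqV (repr x) n = (repr x n)^-1.
  have := @insubdK _ _ (padic_seq p) 0 (fun n => (repr x n)^-1).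
  by move=> /(_ _)/(congr1 (@^~ n)) -> //; exact/asboolP/padic_cauchyV.
rewrite -[X in padic_norm p X < e]/(padic_seqV (repr x) n * repr x n - 1) E.
by rewrite mulVf ?subrr ?padic_norm0 // -(padic_norm_gt0 p) hk.
Qed.

Lemma Qp_inv0 : Qp_inv 0 = 0. Proof. by rewrite /Qp_inv eqxx. Qed.

HB.instance Definition _ := GRing.ComNzRing_isField.Build (Qp p)
  Qp_mulVf Qp_inv0.

End QpField.

(* The extension to [Qp p] of the p-adic absolute value by continuity; the limit
   exists in [rat] because the sequence is eventually constant or tends to 0. *)
Definition Qp_norm (p : nat) (x : Qp p) : rat :=
  lim ((padic_norm p (repr x n) : rat^o) @[n --> \oo]).

Section QpMetric.
Variable p : nat.
Local Open Scope quotient_scope.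
Implicit Types (u v : padic_seq p) (x y z : Qp p).

Lemma rat_cvg_lim (f : nat -> rat^o) (l : rat) :
  (forall e : rat, 0 < e -> exists k, forall n, (k <= n)%N -> `|f n - l| < e) ->
  lim (f n @[n --> \oo]) = l :> rat^o.
Proof.
move=> h; apply: cvg_lim; first exact: metric_hausdorff.
apply/cvg_ballP => e e0; have [k hk] := h e e0.
by exists k => // n /= kn; rewrite /ball /= distrC hk.
Qed.

Lemma Qp_norm0 : Qp_norm (0 : Qp p) = 0.
Proof.
apply: rat_cvg_lim => e e0.
have /Qp_pi_eq0 /(_ e e0) [k hk] : \pi_(Qp p) (repr (0 : Qp p)) = 0 by rewrite reprK.
by exists k => n kn; rewrite subr0 ger0_norm ?padic_norm_ge0 ?hk.
Qed.

Lemma Qp_norm_pi u : \pi_(Qp p) u != 0 ->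
  0 < Qp_norm (\pi_(Qp p) u) /\
  exists k, forall n, (k <= n)%N -> padic_norm p (u n) = Qp_norm (\pi_(Qp p) u).
Proof.
set x := \pi_(Qp p) u => x0; set v := repr x.
have nv : ~ padic_null p v.
  by move/Qp_pi_eq0; rewrite reprK => /eqP; exact/negP.
have [c c0 [k hk]] := padic_norm_stable (padic_seq_cauchy v) nv.
have -> : Qp_norm x = c.
  by apply: rat_cvg_lim => e e0; exists k => n kn; rewrite hk // subrr normr0.
split=> //.
have /Qp_pi_eq /(_ c c0) [l hl] : \pi_(Qp p) v = \pi_(Qp p) u by rewrite reprK.
exists (maxn k l) => n; rewrite geq_max => /andP[kn ln].
by rewrite -(hk n kn); apply: padic_norm_close; rewrite hk //; exact: hl.
Qed.

Lemma Qp_norm_gt0 x : (0 < Qp_norm x) = (x != 0).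
Proof.
have [->|] := eqVneq x 0; first by rewrite Qp_norm0 ltxx.
by rewrite -[x]reprK => /Qp_norm_pi [].
Qed.

Lemma Qp_norm_ge0 x : 0 <= Qp_norm x.
Proof.
by have [->|x0] := eqVneq x 0; [rewrite Qp_norm0 | rewrite ltW ?Qp_norm_gt0].
Qed.

Lemma Qp_norm_eq0 x : (Qp_norm x == 0) = (x == 0).
Proof.
by have := Qp_norm_gt0 x; rewrite lt_neqAle Qp_norm_ge0 andbT eq_sym => /negb_inj.
Qed.

Lemma Qp_normM x y : Qp_norm (x * y) = Qp_norm x * Qp_norm y.
Proof.
have [->|x0] := eqVneq x 0; first by rewrite mul0r Qp_norm0 mul0r.
have [->|y0] := eqVneq y 0; first by rewrite mulr0 Qp_norm0 mulr0.
have := mulf_neq0 x0 y0; move: x0 y0.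
rewrite -[x]reprK -[y]reprK -rmorphM.
move=> /Qp_norm_pi [_ [a ha]] /Qp_norm_pi [_ [b hb]] /Qp_norm_pi [_ [c hc]].
pose n := maxn a (maxn b c).
rewrite -(ha n) -?(hb n) -?(hc n) ?leq_max ?leqnn ?orbT //.
exact: padic_normM.
Qed.

Lemma Qp_normN x : Qp_norm (- x) = Qp_norm x.
Proof.
have [->|x0] := eqVneq x 0; first by rewrite oppr0.
have : - x != 0 by rewrite oppr_eq0.
move: x0; rewrite -[x]reprK -rmorphN.
move=> /Qp_norm_pi [_ [a ha]] /Qp_norm_pi [_ [b hb]].
by rewrite -(ha (maxn a b)) -?(hb (maxn a b)) ?leq_maxl ?leq_maxr // padic_normN.
Qed.

Lemma Qp_norm_ultra x y : Qp_norm (x + y) <= Num.max (Qp_norm x) (Qp_norm y).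
Proof.
have [->|x0] := eqVneq x 0; first by rewrite add0r le_max lexx orbT.
have [->|y0] := eqVneq y 0; first by rewrite addr0 le_max lexx.
have [->|xy0] := eqVneq (x + y) 0; first by rewrite Qp_norm0 le_max Qp_norm_ge0.
move: x0 y0 xy0; rewrite -[x]reprK -[y]reprK -rmorphD.
move=> /Qp_norm_pi [_ [a ha]] /Qp_norm_pi [_ [b hb]] /Qp_norm_pi [_ [c hc]].
pose n := maxn a (maxn b c).
rewrite -(ha n) -?(hb n) -?(hc n) ?leq_max ?leqnn ?orbT //.
exact: padic_norm_ultra.
Qed.

Lemma Qp_normD x y : Qp_norm (x + y) <= Qp_norm x + Qp_norm y.
Proof.
apply: le_trans (Qp_norm_ultra x y) _.
by rewrite ge_max lerDl lerDr !Qp_norm_ge0.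
Qed.

Definition Qp_dist x y : rat := Qp_norm (x - y).

Lemma Qp_distxx x : Qp_dist x x = 0.
Proof. by rewrite /Qp_dist subrr Qp_norm0. Qed.

Lemma Qp_dist_eq0 x y : Qp_dist x y = 0 -> x = y.
Proof. by move=> /eqP; rewrite Qp_norm_eq0 subr_eq0 => /eqP. Qed.

Lemma Qp_distC x y : Qp_dist x y = Qp_dist y x.
Proof. by rewrite /Qp_dist -Qp_normN opprB. Qed.

Lemma Qp_dist_triangle y x z : Qp_dist x z <= Qp_dist x y + Qp_dist y z.
Proof. by rewrite /Qp_dist -(subrKA y) Qp_normD. Qed.

HB.instance Definition _ := isMetric.Build rat (Qp p)
  Qp_distxx Qp_dist_eq0 Qp_distC Qp_dist_triangle.
HB.instance Definition _ := isPointed.Build (Qp p) 0.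

Lemma Qp_ballP x (e : rat) y : ball x e y <-> Qp_norm (x - y) < e.
Proof. by rewrite ballEmdist. Qed.

Definition padic_cst (q : rat) : padic_seq p :=
  PadicSeq (asboolT (padic_cauchy_cst p q)).

Lemma padic_cst_zmod : zmod_morphism padic_cst.
Proof. by move=> a b; apply: val_inj. Qed.

Lemma padic_cst_monoid : monoid_morphism padic_cst.
Proof. by split=> [|a b]; apply: val_inj. Qed.

Let Qp_cst (q : rat) : Qp p := \pi_(Qp p) (padic_cst q).

Let Qp_cst_zmod : zmod_morphism Qp_cst.
Proof. by move=> a b; rewrite /Qp_cst padic_cst_zmod rmorphB. Qed.

Let Qp_cst_monoid : monoid_morphism Qp_cst.
Proof.
have [h1 hM] := padic_cst_monoid.
by split=> [|a b]; rewrite /Qp_cst ?h1 ?hM (rmorph1, rmorphM).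
Qed.

#[local] HB.instance Definition _ := GRing.isZmodMorphism.Build rat (Qp p)
  Qp_cst Qp_cst_zmod.
#[local] HB.instance Definition _ := GRing.isMonoidMorphism.Build rat (Qp p)
  Qp_cst Qp_cst_monoid.

Lemma Qp_ratrE (q : rat) : ratr q = \pi_(Qp p) (padic_cst q) :> Qp p.
Proof. by rewrite -(fmorph_eq_rat Qp_cst). Qed.

Lemma Qp_ratrB : zmod_morphism (ratr : rat -> Qp p).
Proof. by move=> a b; rewrite !Qp_ratrE padic_cst_zmod rmorphB. Qed.

Lemma Qp_ratrM : monoid_morphism (ratr : rat -> Qp p).
Proof.
have [h1 hM] := Qp_cst_monoid; split=> [|a b]; rewrite !Qp_ratrE.
  exact: h1.
exact: hM.
Qed.

Lemma Qp_norm_ratr (q : rat) : Qp_norm (ratr q : Qp p) = padic_norm p q.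
Proof.
rewrite Qp_ratrE; have [/[dup]/Qp_pi_eq0 h ->|] := eqVneq (\pi_(Qp p) (padic_cst q)) 0.
  rewrite Qp_norm0; apply/esym/eqP; rewrite eq_le padic_norm_ge0 andbT leNgt.
  by apply/negP => /h [k /(_ k (leqnn k))]; rewrite ltxx.
by move=> /Qp_norm_pi [_ [k /(_ k (leqnn k))]].
Qed.

Lemma Qp_pi_approx u (e : rat) : 0 < e ->
  exists k, forall n, (k <= n)%N -> Qp_norm ((\pi_(Qp p) u : Qp p) - ratr (u n)) < e.
Proof.
move=> e0; have [k hk] := padic_seq_cauchy u e0; exists k => n kn.
have -> : (\pi_(Qp p) u : Qp p) - ratr (u n) = \pi_(Qp p) (u - padic_cst (u n)).
  by rewrite Qp_ratrE rmorphB.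
set y : Qp p := \pi_(Qp p) _.
have [->|] := eqVneq y 0; first by rewrite Qp_norm0.
move=> /Qp_norm_pi [_ [l hl]]; rewrite -(hl (maxn k l)) ?leq_maxr //.
by apply: hk; rewrite ?leq_maxl.
Qed.

Lemma Qp_dense_rat : dense (range (@ratr (Qp p))).
Proof.
move=> O [x Ox]; rewrite openE => /(_ x Ox) /nbhs_ballP [e e0 xeO].
have [k /(_ k (leqnn k)) hk] := Qp_pi_approx (repr x) e0.
exists (ratr (repr x k)); split; last by exists (repr x k).
by apply/xeO/Qp_ballP; move: hk; rewrite reprK.
Qed.

Lemma Qp_complete (F : set_system (Qp p)) : ProperFilter F -> cauchy F -> cvg F.
Proof.
move=> PF /cauchyP cF.
pose eps (k : nat) : rat := k.+1%:R^-1.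
have eps0 k : 0 < eps k by rewrite invr_gt0 ltr0n.
have small e : 0 < e -> exists k, forall n, (k <= n)%N -> eps n < e.
  move=> e0; exists (Num.truncn e^-1) => n kn.
  rewrite /eps -[e]invrK ltf_pV2 ?posrE ?invr_gt0 ?ltr0n //.
  by rewrite (lt_le_trans (truncnS_gt _)) // ler_nat.
have /choice [q hq] k : exists q : rat, F (ball (ratr q : Qp p) (eps k)).
  have [x Fx] := cF _ (eps0 k).
  have [l /(_ l (leqnn l)) hl] := Qp_pi_approx (repr x) (eps0 k).
  exists (repr x l); apply: filterS Fx => y /Qp_ballP xy; apply/Qp_ballP.
  rewrite -(subrKA x); apply: le_lt_trans (Qp_norm_ultra _ _) _.
  by rewrite gt_max xy andbT -Qp_normN opprB; move: hl; rewrite reprK.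
have qc : padic_cauchy p q.
  move=> e e0; have [k hk] := small e e0; exists k => m n km kn.
  have [y [ym yn]] := filter_ex (filterI (hq m) (hq n)).
  have {}ym := (Qp_ballP _ _ _).1 ym; have {}yn := (Qp_ballP _ _ _).1 yn.
  rewrite -Qp_norm_ratr Qp_ratrB -(subrKA y).
  apply: le_lt_trans (Qp_norm_ultra _ _) _.
  rewrite gt_max (lt_trans ym (hk _ km)) /= -Qp_normN opprB.
  exact: lt_trans yn (hk _ kn).
pose u : padic_seq p := PadicSeq (asboolT qc).
apply/cvg_ex; exists (\pi_(Qp p) u); apply/cvg_ballP => e e0.
have [k hk] := small e e0; have [l hl] := Qp_pi_approx u e0.
have := hq (maxn k l); apply: filterS => y /Qp_ballP h; apply/Qp_ballP.
rewrite -(subrKA (ratr (q (maxn k l)))); apply: le_lt_trans (Qp_norm_ultra _ _) _.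
rewrite gt_max (lt_trans h) ?hk ?leq_maxl // andbT.
by apply: hl; rewrite leq_maxr.
Qed.

HB.instance Definition _ := Uniform_isComplete.Build (Qp p) Qp_complete.

End QpMetric.

Definition quotient_set (x : nat -> int) : set rat :=
  [set q | exists m n, x n != 0 /\ q = (x m)%:~R / (x n)%:~R].

(* Main.v *)
(* Since [x^k - b_1 x^(k-1) - ... - b_k = (x - a)^k], taking the [k-1]-st divided
   derivative of [x^(n-k) (x - a)^k] at [a] shows that [C(n, k-1) a^(n-k+1)]
   satisfies the recurrence, hence equals [x_n].  Put [m = t c] and [n = t d] with
   [t] divisible by [p^N] and by [2 phi(p^N)].  Then [x_m / x_n] is [c / d] times
   [y_m / y_n], where [y_n = (n-1)...(n-k+2) a^n] is congruent mod [p^N] to the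
   nonzero constant [y_0] at both indices; so [x_m / x_n] tends to [c / d] as [N]
   grows, and positive rationals are dense in Q_p. *)
Require Import Defs.
From mathcomp Require Import all_boot all_order all_algebra.
From mathcomp Require Import all_classical topology_theory.topology.
From mathcomp Require Import cyclic zify ring.
Set Implicit Arguments.
Unset Strict Implicit.
Unset Printing Implicit Defensive.
Import Order.TTheory GRing.Theory Num.Theory.
Local Open Scope classical_set_scope.
Local Open Scope ring_scope.

(** * Divided derivatives and the closed form of the recurrence *)

(** Each derivation costs at most one factor ['X - a%:P]; [q] stays arbitrary because the induction
    changes it. *)
Lemma derivn_XsubC_exp_mul (R : comNzRingType) (a : R) (i j : nat)
    (q : {poly R}) :
  exists r, (q * ('X - a%:P) ^+ (i + j))^`(i) = r * ('X - a%:P) ^+ j.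
Proof.
elim: i q => [|i IH] q; first by exists q.
have -> : (q * ('X - a%:P) ^+ (i.+1 + j))^`(i.+1) =
    ((q^`() * ('X - a%:P) + q *+ (i + j).+1) * ('X - a%:P) ^+ (i + j))^`(i).
  rewrite derivSn derivM deriv_exp derivXsubC mul1r addSn /= exprS.
  by rewrite [in RHS]mulrDl mulrnAl mulrnAr mulrA.
exact: IH.
Qed.

(** The factorial relating ordinary and divided derivatives cancels, since [int] has no torsion. *)
Lemma nderivn_XsubC_exp_mul_root (a : int) (i k : nat) (q : {poly int}) :
  (i < k)%N -> (q * ('X - a%:P) ^+ k)^`N(i).[a] = 0.
Proof.
move=> ik; have [r] := derivn_XsubC_exp_mul a i (k - i) q.
rewrite subnKC ?(ltnW ik) // nderivn_def => /(congr1 (horner^~ a)).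
rewrite hornerMn hornerM horner_exp hornerXsubC subrr expr0n subn_eq0 leqNgt ik.
by move=> /eqP; rewrite mulr0 mulrn_eq0 eqn0Ngt fact_gt0 => /eqP.
Qed.

Lemma linrec_binomial (k : nat) (b x : nat -> int) (a : int) : (0 < k)%N ->
  (forall n : nat, (k <= n)%N ->
     x n = \sum_(1 <= i < k.+1) b i * x (n - i)%N) ->
  (forall n : nat, (n < k.-1)%N -> x n = 0) -> x k.-1 = 1 ->
  'X^k - \sum_(1 <= i < k.+1) (b i)%:P * 'X^(k - i)
    = ('X - a%:P) ^+ k :> {poly int} ->
  forall n, x n = a ^+ (n - k.-1) *+ 'C(n, k.-1).
Proof.
move=> k0 hrec hx0 hx1 hchar; elim/ltn_ind => n IH.
have [nk|kn] := ltnP n k.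
  have [nk'|kn'] := ltnP n k.-1; first by rewrite hx0 // bin_small.
  have -> : n = k.-1 by lia.
  by rewrite hx1 subnn binn.
rewrite hrec //.
have kk : (k.-1 < k)%N by lia.
(* Expanded through [hchar], this vanishing derivative is the recurrence for the closed form. *)
have := @nderivn_XsubC_exp_mul_root a k.-1 k 'X^(n - k) kk.
rewrite -hchar mulrBr -exprD subnK // big_distrr /= nderivnB linear_sum /=.
rewrite nderivnXn hornerD hornerN horner_sum hornerMn hornerXn.
move/eqP; rewrite subr_eq0 => /eqP ->; apply: eq_big_nat => i /andP[i0 ik].
have -> : 'X^(n - k) * ((b i)%:P * 'X^(k - i)) = b i *: 'X^(n - i) :> {poly int}.
  rewrite mulrCA -exprD mul_polyC; congr (_ *: 'X^_); lia.
rewrite nderivnZ nderivnXn hornerZ hornerMn hornerXn IH //; lia.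
Qed.

(** * Falling factorials, congruences and p-adic smallness *)

(** For [n < m] the factor with [i = n] makes the product vanish. Unlike the truncated form, the
    factors over [int] can be reduced modulo [q]. *)
Lemma ffact_intE (n m : nat) :
  (n ^_ m)%:Z = \prod_(i < m) (n%:Z - i%:Z).
Proof.
elim: m => [|m IH]; first by rewrite big_ord0 ffactn0.
rewrite big_ord_recr /= -IH ffactnSr.
have [nm|mn] := ltnP n m; first by rewrite ffact_small // mul0r.
by rewrite PoszM subzn.
Qed.

Lemma dvdz_subM (q u u' v v' : int) :
  (q %| u - u')%Z -> (q %| v - v')%Z -> (q %| u * v - u' * v')%Z.
Proof.
move=> hu hv; have -> : u * v - u' * v' = (u - u') * v + u' * (v - v') by ring.
by rewrite rpredD // ?(dvdz_mulr _ hu) ?(dvdz_mull _ hv).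
Qed.

(* The factor 2 in the exponent makes the sign of [a] irrelevant. *)
Lemma Euler_exp_double_totient (a : int) (q j : nat) : coprime `|a| q ->
  (q%:Z %| a ^+ (2 * totient q * j) - 1)%Z.
Proof.
move=> aq; rewrite -mulnA exprM -real_normK ?num_real // -exprM mulnCA exprM.
rewrite -abszE -eqz_mod_dvd -!natz -!natrX !natz.
have : ((`|a| ^ totient q) ^ (2 * j) = 1 %[mod q])%N.
  by rewrite -modnXm Euler_exp_totient // modnXm exp1n.
by rewrite !modz_nat => ->.
Qed.

Lemma padic_norm_dvd_le (p N : nat) (z : int) : prime p ->
  ((p ^ N)%N%:Z %| z)%Z -> padic_norm p z%:~R <= p%:R ^- N.
Proof.
move=> pp; have [->|z0] := eqVneq z 0.
  by rewrite padic_norm0 invr_ge0 exprn_ge0.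
rewrite dvdzE absz_nat pfactor_dvdn ?absz_gt0 // padic_normz // => h.
have p1 : 1 < p%:R :> rat by rewrite ltr1n prime_gt1.
by rewrite lef_pV2 ?posrE ?exprn_gt0 ?ler_eXn2l // (lt_trans _ p1).
Qed.

Lemma expVn_lt_eventually (p : nat) (e : rat) : (1 < p)%N -> 0 < e ->
  exists N0, forall N, (N0 <= N)%N -> p%:R ^- N < e.
Proof.
(* Exceeding [e^-1] is enough, since [p ^ N] is larger than [N]. *)
move=> p1 e0; exists (Num.truncn e^-1).+1 => N hN.
have p0 : 0 < p%:R ^+ N :> rat by rewrite exprn_gt0 // ltr0n ltnW.
rewrite -[e]invrK ltf_pV2 ?posrE ?invr_gt0 // -natrX.
rewrite (lt_le_trans (truncnS_gt _)) // ler_nat.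
by rewrite (leq_trans hN) // ltnW // ltn_expl.
Qed.

(* The [y_n] of the proof idea above, for [k = j.+2]. *)
Definition binom_factor (j : nat) (a : int) (n : nat) : int :=
  (\prod_(i < j) (n%:Z - i.+1%:Z)) * a ^+ n.

(** Splitting [n] off the falling factorial is what later produces [c / d]; the constant multiplier
    on the left cancels in ratios. *)
Lemma binom_factorE (j : nat) (a : int) (n : nat) : (j < n)%N ->
  (a ^+ (n - j.+1) *+ 'C(n, j.+1)) * (j.+1`!%:Z * a ^+ j.+1)
    = n%:Z * binom_factor j a n.
Proof.
move=> jn; rewrite /binom_factor -mulr_natr natz.
have -> : a ^+ n = a ^+ (n - j.+1) * a ^+ j.+1 by rewrite -exprD subnK.
have := ffact_intE n j.+1; rewrite -bin_ffact PoszM big_ord_recl subr0 => E.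
have {E} : 'C(n, j.+1)%:Z * j.+1`!%:Z
   = n%:Z * \prod_(i < j) (n%:Z - i.+1%:Z) by rewrite E.
set A := Posz 'C(_, _); set B := Posz _`!; set C := \prod_(i < j) _ => E.
by rewrite [RHS]mulrA -E; ring.
Qed.

(** Modulo [q], each factor [n - (i + 1)] becomes [-(i + 1)] and the power of [a] becomes 1. *)
Lemma binom_factor_mod (j : nat) (a : int) (q n : nat) :
  (q %| n)%N -> (q%:Z %| a ^+ n - 1)%Z ->
  (q%:Z %| binom_factor j a n - binom_factor j a 0)%Z.
Proof.
move=> qn qa; rewrite /binom_factor; apply: dvdz_subM => //.
apply: (big_ind2 (fun u v => (q%:Z %| u - v)%Z)) => [||i _]; first by rewrite subrr.
  by move=> u u' v v'; apply: dvdz_subM.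
by rewrite sub0r opprK subrK.
Qed.

Lemma binom_factor0_neq0 (j : nat) (a : int) : binom_factor j a 0 != 0.
Proof.
rewrite /binom_factor expr0 mulr1; apply/prodf_neq0 => i _.
by rewrite sub0r oppr_eq0.
Qed.

(** * Approximation of rationals by ratios of terms *)

Lemma binomial_ratio_approx (j : nat) (a : int) (p : nat) (c d : nat) (e : rat) :
  prime p -> ~~ (p%:Z %| a)%Z -> (0 < c)%N -> (0 < d)%N -> 0 < e ->
  exists m n, let x i := a ^+ (i - j.+1) *+ 'C(i, j.+1) in
    x n != 0 /\ padic_norm p (c%:R / d%:R - (x m)%:~R / (x n)%:~R) < e.
Proof.
move=> pp pa c0 d0 e0; pose y := binom_factor j a; pose r : rat := c%:R / d%:R.
have p1 := prime_gt1 pp.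
have Ny0 : 0 < padic_norm p (y 0%N)%:~R.
  by rewrite padic_norm_gt0 intr_eq0 binom_factor0_neq0.
have r0 : r != 0 by rewrite mulf_neq0 ?invr_eq0 ?pnatr_eq0 -?lt0n.
have Nr0 : 0 < padic_norm p r by rewrite padic_norm_gt0.
have [N1 h1] := expVn_lt_eventually p1 Ny0.
have [N2 h2] := expVn_lt_eventually p1
  (divr_gt0 (mulr_gt0 e0 Ny0) Nr0).
(* [j] ensures [j < t]; [N1] puts [y (t * s)] closer to [y 0] than the norm of [y 0], so both have
   the same norm; [N2] brings the final error below [e]. *)
pose N := (j + N1 + N2)%N; pose q := (p ^ N)%N.
have q0 : (0 < q)%N by rewrite expn_gt0 prime_gt0.
pose t := (2 * totient q * q)%N.
have jt : (j < t)%N.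
  have : (N < q)%N by rewrite ltn_expl.
  have : (0 < totient q)%N by rewrite totient_gt0.
  rewrite /t /N; nia.
have yE s : ((p ^ N)%N%:Z %| y (t * s)%N - y 0%N)%Z.
  apply: binom_factor_mod.
    by rewrite /t -mulnA mulnCA dvdn_mulr.
  rewrite -mulnA; apply: Euler_exp_double_totient.
  by rewrite coprime_sym coprimeXl // prime_coprime.
clearbody t.
have yn0 s : padic_norm p (y (t * s)%N)%:~R = padic_norm p (y 0%N)%:~R.
  apply: padic_norm_close; rewrite -intrB -opprB intrN padic_normN.
  by apply: le_lt_trans (h1 N _); [exact: padic_norm_dvd_le | rewrite /N; lia].
have yD : padic_norm p ((y (t * d)%N)%:~R - (y (t * c)%N)%:~R) <= p%:R ^- N.
  rewrite -intrB; apply: padic_norm_dvd_le => //.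
  by rewrite -(subrKA (y 0%N)) rpredD // -opprB rpredN.
exists (t * c)%N, (t * d)%N => x.
have a0 : a != 0 by apply: contraNneq pa => ->.
have F0 : ((j.+1)`!%:Z * a ^+ j.+1) != 0.
  by rewrite mulf_neq0 ?expf_neq0 // -lt0n fact_gt0.
have xE s : (0 < s)%N -> (x (t * s)%N)%:~R =
    (t * s)%:R * (y (t * s)%N)%:~R / ((j.+1)`!%:Z * a ^+ j.+1)%:~R :> rat.
  move=> s0; apply: (canRL (mulfK _)); first by rewrite intr_eq0.
  by rewrite -intrM binom_factorE ?intrM // (leq_trans jt) // leq_pmulr.
have yd0 : (y (t * d)%N)%:~R != 0 :> rat by rewrite -(padic_norm_gt0 p) yn0.
have t0 : t%:R != 0 :> rat by rewrite pnatr_eq0; lia.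
have dd0 : d%:R != 0 :> rat by rewrite pnatr_eq0; lia.
split.
  by rewrite -(@intr_eq0 rat) xE // mulf_neq0 ?invr_eq0 ?intr_eq0 // mulf_neq0 //
     natrM mulf_neq0.
(* The error is [r] times one minus the ratio of the [y] values, since [t] and the constant
   cancel. *)
have -> : c%:R / d%:R - (x (t * c)%N)%:~R / (x (t * d)%N)%:~R =
   r * (((y (t * d)%N)%:~R - (y (t * c)%N)%:~R) / (y (t * d)%N)%:~R) :> rat.
  have F0' : ((j.+1)`!%:Z * a ^+ j.+1)%:~R != 0 :> rat by rewrite intr_eq0.
  rewrite !xE // !natrM /r; move: F0' yd0 t0 dd0.
  move: ((_ * a ^+ _)%:~R) => F F0' yd0 t0 dd0.
  by field; rewrite yd0 dd0 F0' t0.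
rewrite padic_normM (padic_normM _ (_ - _)) padic_normV yn0 mulrA ltr_pdivrMr //.
rewrite mulrC -ltr_pdivlMr //; apply: le_lt_trans yD _.
by apply: h2; rewrite /N; lia.
Qed.

(** Adding a large enough multiple of a high power of [p] makes [r] positive and moves it little
    p-adically. *)
Lemma rat_pos_approx (p : nat) (r e : rat) : prime p -> 0 < e ->
  exists c d, [/\ (0 < c)%N, (0 < d)%N & padic_norm p (r - c%:R / d%:R) < e].
Proof.
move=> pp e0; have p1 := prime_gt1 pp.
have [N /(_ N (leqnn N)) hN] := expVn_lt_eventually p1 e0.
pose T := (p ^ N * (Num.truncn `|r|).+1)%N; pose s := r + T%:R.
have s0 : 0 < s.
  rewrite -ltrBlDl sub0r; apply: le_lt_trans (ler_norm _) _; rewrite normrN.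
  apply: lt_le_trans (truncnS_gt _) _.
  by rewrite ler_nat leq_pmull // expn_gt0 prime_gt0.
exists `|numq s|%N, `|denq s|%N.
split; [by rewrite absz_gt0 numq_eq0 gt_eqF | by rewrite absz_gt0 denq_neq0 |].
have -> : `|numq s|%N%:R / `|denq s|%N%:R = s.
  rewrite -[RHS]divq_num_den; congr (_ / _); rewrite natr_absz ger0_norm //.
  by rewrite numq_ge0 ltW.
have -> : r - s = - (T%:Z)%:~R by rewrite /s opprD addrA subrr add0r.
rewrite padic_normN; apply: le_lt_trans hN; apply: padic_norm_dvd_le => //.
by rewrite dvdzE !absz_nat dvdn_mulr.
Qed.

Theorem theorem1p3 (k : nat) (hk : (2 <= k)%N)
    (b : nat -> int) (hbk : b k != 0) (x : nat -> int)
    (hrec : forall n : nat, (k <= n)%N ->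
       x n = \sum_(1 <= i < k.+1) b i * x (n - i)%N)
    (hx0 : forall n : nat, (n < k.-1)%N -> x n = 0)
    (hx1 : x k.-1 = 1)
    (a : int)
    (hchar : 'X^k - \sum_(1 <= i < k.+1) (b i)%:P * 'X^(k - i)
             = ('X - a%:P) ^+ k :> {poly int})
    (p : nat) (hp : prime p) (hpa : ~~ (p%:Z %| a)%Z) :
  dense ((ratr : rat -> Qp p) @` quotient_set x).
Proof.
have xE := linrec_binomial (ltnW hk) hrec hx0 hx1 hchar.
have [j kE] : exists j, k.-1 = j.+1 by exists k.-2; lia.
rewrite kE in xE => O O0 Oo.
have [_ [/[swap] [[q _ <-]] Oq]] := Qp_dense_rat O0 Oo.
move: Oo; rewrite openE => /(_ _ Oq) /nbhs_ballP [e e0 qeO].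
(* By the ultrametric inequality both approximations can use the same [e], without halving. *)
have [c [d [c0 d0 qcd]]] := rat_pos_approx q hp e0.
have [m [n [xn0 cdx]]] := binomial_ratio_approx j hp hpa c0 d0 e0.
exists (ratr ((x m)%:~R / (x n)%:~R)); split; last first.
  by eexists; last reflexivity; exists m, n; rewrite xE.
apply/qeO/Qp_ballP; rewrite -Qp_ratrB Qp_norm_ratr.
by rewrite -(subrKA (c%:R / d%:R)) !xE; apply: padic_normD_lt.
Qed.
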